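(* Let $\Delta t>0$ and let $(U^n)_{n\ge0}$ be a sequence in $\mathbb{R}^M$ which complies with the BDF3 scheme $$\frac{11}{6}U^{n+3}-3U^{n+2}+\frac32U^{n+1}-\frac13U^n\in-\Delta t\,\partial F(U^{n+3}),\quad n\ge0.$$ Assume that $c_F\Delta t<2\beta_3$ and let $\beta$ be chosen arbitrarily in $[c_F\Delta t/2,\beta_3)$. Then for each $n\ge0$ we have $$\hat F_3^\beta(\hat U^{n+3})+\frac{1}{\Delta t}\tilde R_3^\beta(\partial U^{n+3},\partial U^{n+2},\partial U^{n+1})\le\hat F_3^\beta(\hat U^{n+2}).$$
   Context: Assumptions on $F$. $\mathbb{R}^M$ carries the Euclidean norm $\|\cdot\|$ and scalar product $\langle\cdot,\cdot\rangle$. $F:\mathbb{R}^M\to\mathbb{R}\cup\{+\infty\}$ is proper and lower semicontinuous, and semiconvex: there is a constant $c\ge0$ such that $V\mapsto F(V)+\frac{c}{2}\|V\|^2$ is convex; $c_F\ge0$ denotes the smallest such constant. Moreover $F$ is continuous on its domain $\mathrm{dom}(F)=\{V: F(V)<+\infty\}$, and $\inf_{\mathbb{R}^M}F>-\infty$. The subdifferential $\partial F$ is the set-valued map on $\mathbb{R}^M$ defined by $$W\in\partial F(V)\iff\forall V'\in\mathbb{R}^M,\ F(V')\ge F(V)+\langle W,V'-V\rangle-\frac{c_F}{2}\|V'-V\|^2,$$ with $\partial F(V)=\emptyset$ if $V\notin\mathrm{dom}(F)$. Backward difference. For a sequence $(U^n)_{n\ge 0}$, $\partial U^n=U^n-U^{n-1}$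 ($n\ge1$). The constant $\beta_3$ and the quadratic forms. Let $\gamma_3(x_1,x_2,x_3)=\frac{11}{6}x_1^2-\frac76x_1x_2+\frac13x_1x_3$ on $\mathbb{R}^3$. $\beta_3$ is the supremum of the real numbers $\beta>0$ for which there exist a positive definite quadratic form $q_3$ on $\mathbb{R}^2$ and a positive definite quadratic form $\tilde r_3$ on $\mathbb{R}^3$ with $$\gamma_3(x_1,x_2,x_3)=q_3(x_1,x_2)-q_3(x_2,x_3)+\tilde r_3(x_1,x_2,x_3)+\beta x_1^2\quad\text{for all }(x_1,x_2,x_3)\in\mathbb{R}^3;$$ its value is $\beta_3=95/96$. For each $\beta<\beta_3$ such a pair of positive definite forms exists; fix one and denote it $q_3^\beta$, $\tilde r_3^\beta$. To a quadratic form $q(x_1,\dots,x_d)=\sum_{i,j}a_{ij}x_ix_j$ on $\mathbb{R}^d$ with symmetric matrix $(a_{ij})$ one associates the quadratic form $Q(V_1,\dots,V_d)=\sum_{i,j}a_{ij}\langle V_i,V_j\rangle$ on $(\mathbb{R}^M)^d$. $Q_3^\beta$ on $(\mathbb{R}^M)^2$ and $\tilde R_3^\beta$ on $(\mathbb{R}^M)^3$ are the forms associated in this way with $q_3^\beta$ and $\tilde r_3^\beta$. The functional. For $\hat V=(V_0,V_1,V_2)\in(\mathbb{R}^M)^3$, $$\hat F_3^\beta(\hat V)=F(V_0)+\frac{1}{\Delta t}Q_3^\beta(V_1,V_2),$$ and, for a sequence $(U^n)_{n\ge0}$ and $m\ge2$, $\hat U^{m}=(U^{m},\partial U^{m},\partial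 U^{m-1})$. The value $+\infty$ is allowed. *)

(* Defs.v *)
From HB Require Import structures.
From mathcomp Require Import all_boot all_order all_algebra.
From mathcomp Require Import all_classical all_reals all_analysis.
From mathcomp Require Import ring lra.

Set Implicit Arguments.
Unset Strict Implicit.
Unset Printing Implicit Defensive.

Import Order.TTheory GRing.Theory Num.Theory.
Import numFieldNormedType.Exports.
Local Open Scope classical_set_scope.
Local Open Scope ring_scope.

(* [`|V|] is the sup norm on row vectors, hence an explicit Euclidean
   structure.  The canonical topology of ['rV[R]_M] is the Euclidean one, all
   norms being equivalent. *)
Definition dot (R : realType) (M : nat) (u v : 'rV[R]_M) : R :=
  \sum_(i < M) u 0 i * v 0 i.

Definition enorm (R : realType) (M : nat) (u : 'rV[R]_M) : R :=
  Num.sqrt (dot u u).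

Definition edom (R : realType) (T : Type) (F : T -> \bar R) : set T :=
  [set V | (F V < +oo)%E].

Definition eproper (R : realType) (T : Type) (F : T -> \bar R) : Prop :=
  (forall V, F V != -oo%E) /\ edom F !=set0.

(* In [\bar R], [0 * +oo = 0], so that [t = 0] and [t = 1] are harmless. *)
Definition econvex (R : realType) (M : nat) (G : 'rV[R]_M -> \bar R) : Prop :=
  forall (x y : 'rV[R]_M) (t : R), 0 <= t <= 1 ->
    (G (t *: x + (1 - t) *: y)%R
       <= t%:E * G x + (1 - t)%:E * G y)%E.

Definition semiconvex_with (R : realType) (M : nat)
    (F : 'rV[R]_M -> \bar R) (c : R) : Prop :=
  0 <= c /\ econvex (fun V => (F V + (c / 2 * enorm V ^+ 2)%:E)%E).

Definition semiconvex (R : realType) (M : nat)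
    (F : 'rV[R]_M -> \bar R) : Prop :=
  exists c : R, semiconvex_with F c.

(* The infimum is attained: see [semiconvexity_cst_least]. *)
Definition semiconvexity_cst (R : realType) (M : nat)
    (F : 'rV[R]_M -> \bar R) : R :=
  inf [set c | semiconvex_with F c].

Definition subdiff (R : realType) (M : nat) (F : 'rV[R]_M -> \bar R)
    (V : 'rV[R]_M) : set 'rV[R]_M :=
  [set W | edom F V /\
    forall V' : 'rV[R]_M,
      (F V + (dot W (V' - V))%:E
         - (semiconvexity_cst F / 2 * enorm (V' - V) ^+ 2)%:E <= F V')%E].

(* Only meant for [n >= 1]. *)
Definition bdiff (V : zmodType) (U : nat -> V) (n : nat) : V :=
  U n - U n.-1.

(* A quadratic form on [R^d] is represented by its symmetric matrix [A]. *)
Definition qform (R : realType) (d : nat) (A : 'M[R]_d)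
    (x : d.-tuple R) : R :=
  \sum_(i < d) \sum_(j < d) A i j * tnth x i * tnth x j.

Definition vqform (R : realType) (d M : nat) (A : 'M[R]_d)
    (V : d.-tuple 'rV[R]_M) : R :=
  \sum_(i < d) \sum_(j < d) A i j * dot (tnth V i) (tnth V j).

Definition posdef (R : realType) (d : nat) (A : 'M[R]_d) : Prop :=
  A^T = A /\
  forall x : d.-tuple R, (exists i, tnth x i != 0) -> 0 < qform A x.

Definition gamma3 (R : realType) (x1 x2 x3 : R) : R :=
  11 / 6 * x1 ^+ 2 - 7 / 6 * (x1 * x2) + 1 / 3 * (x1 * x3).

Definition decomp3 (R : realType) (beta : R) (q : 'M[R]_2) (r : 'M[R]_3) :
    Prop :=
  [/\ posdef q, posdef r &
    forall x1 x2 x3 : R,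
      gamma3 x1 x2 x3 = qform q [tuple x1; x2] - qform q [tuple x2; x3]
        + qform r [tuple x1; x2; x3] + beta * x1 ^+ 2].

Definition beta3_set (R : realType) : set R :=
  [set beta | 0 < beta /\ exists q r, decomp3 beta q r].

Definition beta3 (R : realType) : R := sup (@beta3_set R).

Definition Fhat3 (R : realType) (M : nat) (F : 'rV[R]_M -> \bar R) (dt : R)
    (q : 'M[R]_2) (V : 'rV[R]_M * 'rV[R]_M * 'rV[R]_M) : \bar R :=
  (F V.1.1 + (dt^-1 * vqform q [tuple V.1.2; V.2])%:E)%E.

(* Only meant for [m >= 2]. *)
Definition Uhat (R : realType) (M : nat) (U : nat -> 'rV[R]_M) (m : nat) :
    'rV[R]_M * 'rV[R]_M * 'rV[R]_M :=
  (U m, bdiff U m, bdiff U m.-1).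

Definition BDF3 (R : realType) (M : nat) (F : 'rV[R]_M -> \bar R) (dt : R)
    (U : nat -> 'rV[R]_M) : Prop :=
  forall n : nat,
    [set - dt *: W | W in subdiff F (U n.+3)]
      ((11 / 6) *: U n.+3 - 3 *: U n.+2 + (3 / 2) *: U n.+1
         - (1 / 3) *: U n).

Lemma semiconvexity_cst_least (R : realType) (M : nat)
    (F : 'rV[R]_M -> \bar R) :
  (forall V, F V != -oo%E) -> semiconvex F ->
  semiconvex_with F (semiconvexity_cst F) /\
  forall c, semiconvex_with F c -> semiconvexity_cst F <= c.
Proof.
move=> FN [c0 c0P]; rewrite /semiconvexity_cst.
set S := [set c | semiconvex_with F c].
have S0 : S !=set0 by exists c0.
have hlb : has_lbound S by exists 0 => c [].
have lei c : S c -> inf S <= c by move=> Sc; exact: ge_inf.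
split=> //; split; first by apply: lb_le_inf => // c [].
move=> x y t /andP[t0 t1].
have [->|tn0] := eqVneq t 0.
  by rewrite subr0 scale0r add0r scale1r mul0e mul1e add0e.
have [->|tn1] := eqVneq t 1.
  by rewrite subrr scale0r addr0 scale1r mul0e mul1e adde0.
have tp : 0 < t by rewrite lt_def tn0.
have sp : 0 < 1 - t by rewrite subr_gt0 lt_def eq_sym tn1.
have key c : S c -> (F (t *: x + (1 - t) *: y)%R +
    (c / 2 * enorm (t *: x + (1 - t) *: y)%R ^+ 2)%:E
      <= t%:E * (F x + (c / 2 * enorm x ^+ 2)%:E)
         + (1 - t)%:E * (F y + (c / 2 * enorm y ^+ 2)%:E))%E.
  by case=> _; apply; rewrite t0.
move: key; set z := (t *: x + (1 - t) *: y)%R => key /=.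
move: (FN x) (FN y) (FN z) key.
case: (F x) => [X||] // _; last first.
  move=> + _ _; case: (F y) => [Y||] // _.
  - by rewrite addye // gt0_muley ?lte_fin // -EFinD -EFinM addye // leey.
  - by rewrite !addye // !gt0_muley ?lte_fin // leey.
case: (F y) => [Y||] // _; last first.
  by move=> _ _; rewrite addye // gt0_muley ?lte_fin // -EFinD -EFinM addey // leey.
case: (F z) => [Z||] // _ key; last by have := key _ c0P.
have {}key c : S c ->
    Z + c / 2 * enorm z ^+ 2 <= t * (X + c / 2 * enorm x ^+ 2)
       + (1 - t) * (Y + c / 2 * enorm y ^+ 2).
  by move=> /key; rewrite -!EFinD.
rewrite -!EFinD lee_fin.
pose D := t * enorm x ^+ 2 + (1 - t) * enorm y ^+ 2 - enorm z ^+ 2.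
pose A := Z - t * X - (1 - t) * Y.
have {}key c : S c -> A <= c / 2 * D.
  by move=> /key; rewrite /A /D; lra.
suff : A <= inf S / 2 * D by rewrite /A /D; lra.
have [D0|D0|D0] := ltgtP D 0.
- have h1 := key _ c0P; have h2 := lei _ c0P.
  by apply: (le_trans h1); rewrite ler_nM2r // ler_pM2r // invr_gt0.
- have h : 2 * A / D <= inf S.
    apply: lb_le_inf => // c /key h; rewrite ler_pdivrMr //; lra.
  move: h; rewrite ler_pdivrMr //; lra.
- by have := key _ c0P; rewrite D0 !mulr0.
Qed.

Lemma beta3_has_sup (R : realType) : has_sup (@beta3_set R).
Proof.
split; last first.
  exists 1 => b [_ [q [r [_ [_ rp] dec]]]].
  have := dec 1 1 1; rewrite /gamma3 subrr add0r.
  have : 0 < qform r [tuple 1; 1; 1].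
    by apply: rp; exists 0; rewrite (tnth_nth 0) /= oner_neq0.
  lra.
pose q : 'M[R]_2 := \matrix_(i, j)
  nth 0 (nth [::] [:: [:: 2 / 3; - 1 / 6]; [:: - 1 / 6; 1 / 3]] i) j.
pose r : 'M[R]_3 := \matrix_(i, j)
  nth 0 (nth [::] [:: [:: 1; - 5 / 12; 1 / 6];
                      [:: - 5 / 12; 1 / 3; - 1 / 6];
                      [:: 1 / 6; - 1 / 6; 1 / 3]] i) j.
exists (1 / 6); split; first lra.
have qE (x : 2.-tuple R) : qform q x =
    2 / 3 * x`_0 ^+ 2 - 1 / 3 * (x`_0 * x`_1) + 1 / 3 * x`_1 ^+ 2.
  rewrite /qform !big_ord_recl !big_ord0 !mxE /= !(tnth_nth 0) /=.
  by field.
have rE (x : 3.-tuple R) : qform r x =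
    (x`_0 - 5 / 12 * x`_1 + 1 / 6 * x`_2) ^+ 2
    + 11 / 36 * (x`_2 - 7 / 22 * x`_1) ^+ 2
    + (23 / 144 - 49 / 1584) * x`_1 ^+ 2.
  rewrite /qform !big_ord_recl !big_ord0 !mxE /= !(tnth_nth 0) /=.
  by field.
exists q, r; split.
- split; first by apply/matrixP => -[[|[|[]]] //= ?] [[|[|[]]] //= ?]; rewrite !mxE.
  move=> x xn0; rewrite qE.
  have e : 2 / 3 * x`_0 ^+ 2 - 1 / 3 * (x`_0 * x`_1) + 1 / 3 * x`_1 ^+ 2 =
    1 / 3 * (x`_1 - 1 / 2 * x`_0) ^+ 2 + 7 / 12 * x`_0 ^+ 2 by field.
  rewrite e lt_def; apply/andP; split; last first.
    by rewrite addr_ge0 // mulr_ge0 ?sqr_ge0 //; lra.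
  apply/eqP => h.
  have s1 := sqr_ge0 (x`_1 - 1 / 2 * x`_0).
  have s2 := sqr_ge0 x`_0.
  have /eqP : x`_0 ^+ 2 = 0 by lra.
  have /eqP : (x`_1 - 1 / 2 * x`_0) ^+ 2 = 0 by lra.
  rewrite !sqrf_eq0 => /eqP h1 /eqP h0.
  have {}h1 : x`_1 = 0 by lra.
  by case: xn0 => -[[|[|[]]] //= ?]; rewrite (tnth_nth 0) /= ?h0 ?h1 eqxx.
- split.
    by apply/matrixP => -[[|[|[|[]]]] //= ?] [[|[|[|[]]]] //= ?]; rewrite !mxE.
  move=> x xn0; rewrite rE.
  have s1 := sqr_ge0 (x`_0 - 5 / 12 * x`_1 + 1 / 6 * x`_2).
  have s2 := sqr_ge0 (x`_2 - 7 / 22 * x`_1).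
  have s3 := sqr_ge0 x`_1.
  rewrite lt_def; apply/andP; split; last by lra.
  apply/eqP => h.
  have /eqP : x`_1 ^+ 2 = 0 by lra.
  have /eqP : (x`_2 - 7 / 22 * x`_1) ^+ 2 = 0 by lra.
  have /eqP : (x`_0 - 5 / 12 * x`_1 + 1 / 6 * x`_2) ^+ 2 = 0 by lra.
  rewrite !sqrf_eq0 => /eqP h0 /eqP h2 /eqP h1.
  have {}h2 : x`_2 = 0 by lra.
  have {}h0 : x`_0 = 0 by lra.
  by case: xn0 => -[[|[|[|[]]]] //= ?]; rewrite (tnth_nth 0) /= ?h0 ?h1 ?h2 eqxx.
- move=> x1 x2 x3; rewrite /gamma3 !qE rE /=.
  by field.
Qed.

Lemma decomp3_exists (R : realType) (beta : R) :
  beta < beta3 R -> exists q r, decomp3 beta q r.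
Proof.
move=> bl; have [b [b0 [q [r [qp [rs rp] dec]]]] bb] :=
  sup_adherent (eps := beta3 R - beta) ltac:(by rewrite subr_gt0)
    (beta3_has_sup R).
have {}bb : beta < b by move: bb; rewrite -/(beta3 R) subKr.
exists q, (r + (b - beta) *: delta_mx 0 0).
have rE (x : 3.-tuple R) : qform (r + (b - beta) *: delta_mx 0 0) x =
    qform r x + (b - beta) * x`_0 ^+ 2.
  rewrite /qform !big_ord_recl !big_ord0 !mxE /= !(tnth_nth 0) /=.
  by ring.
split=> //.
- split; first by rewrite linearD linearZ /= trmx_delta rs.
  move=> x xn0; rewrite rE ltr_wpDr ?rp //.
  by rewrite mulr_ge0 ?sqr_ge0 // subr_ge0 ltW.
- by move=> x1 x2 x3; rewrite dec rE /=; ring.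
Qed.

(* Main.v *)
(** Testing the subgradient inequality at [V' = U n.+2] and multiplying by [dt]
    produces the vector version of [gamma3] at the differences [V1], [V2], [V3]
    of [U] at [n.+3], [n.+2], [n.+1].  In its decomposition the [q] terms
    telescope, and [beta * |V1|^2] absorbs the semiconvexity defect
    [c_F * dt / 2 * |V1|^2]. *)
Require Import Defs.
From mathcomp Require Import all_boot all_order all_algebra.
From mathcomp Require Import all_classical all_reals all_analysis.
From mathcomp Require Import ring lra.

Import Order.TTheory GRing.Theory Num.Theory.
Import numFieldNormedType.Exports.
Local Open Scope classical_set_scope.
Local Open Scope ring_scope.

Lemma dot_ge0 (R : realType) (M : nat) (u : 'rV[R]_M) : 0 <= dot u u.
Proof. by apply: sumr_ge0 => i _; rewrite -expr2 sqr_ge0. Qed.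

Lemma sqr_enorm (R : realType) (M : nat) (u : 'rV[R]_M) :
  enorm u ^+ 2 = dot u u.
Proof. by rewrite sqr_sqrtr ?dot_ge0. Qed.

Lemma dotZl (R : realType) (M : nat) (a : R) (u v : 'rV[R]_M) :
  dot (a *: u) v = a * dot u v.
Proof.
by rewrite /dot mulr_sumr; apply: eq_bigr => i _; rewrite mxE mulrA.
Qed.

Lemma dotNr (R : realType) (M : nat) (u v : 'rV[R]_M) :
  dot u (- v) = - dot u v.
Proof. by rewrite /dot -sumrN; apply: eq_bigr => i _; rewrite mxE mulrN. Qed.

(** Since [dot] is a sum over coordinates, scalar identities between quadratic forms transfer to
    vectors one coordinate at a time. *)
Lemma vqform_coord (R : realType) (d M : nat) (A : 'M[R]_d)
    (V : d.-tuple 'rV[R]_M) :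
  vqform A V = \sum_(k < M) qform A (map_tuple (fun v : 'rV_M => v 0 k) V).
Proof.
rewrite /vqform /qform [RHS]exchange_big /=; apply: eq_bigr => i _.
rewrite [RHS]exchange_big /=; apply: eq_bigr => j _.
rewrite /dot mulr_sumr; apply: eq_bigr => k _.
by rewrite !tnth_map mulrA.
Qed.

(** The left side is the sum over [k] of [gamma3] at the [k]-th coordinates, so the scalar identity
    in [decomp3] applies termwise. *)
Lemma dot_gamma3 (R : realType) (M : nat) (beta : R) (q : 'M[R]_2)
    (r : 'M[R]_3) (V1 V2 V3 : 'rV[R]_M) :
  decomp3 beta q r ->
  dot ((11 / 6) *: V1 - (7 / 6) *: V2 + (1 / 3) *: V3) V1 =
    vqform q [tuple V1; V2] - vqform q [tuple V2; V3]
    + vqform r [tuple V1; V2; V3] + beta * dot V1 V1.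
Proof.
case=> _ _ dec; rewrite !vqform_coord /dot mulr_sumr -sumrB -!big_split /=.
apply: eq_bigr => k _; rewrite !mxE.
have := dec (V1 0 k) (V2 0 k) (V3 0 k).
have tE2 (x y : 'rV[R]_M) :
    map_tuple (fun v : 'rV_M => v 0 k) [tuple x; y] = [tuple x 0 k; y 0 k].
  exact: val_inj.
have tE3 (x y z : 'rV[R]_M) :
    map_tuple (fun v : 'rV_M => v 0 k) [tuple x; y; z] =
    [tuple x 0 k; y 0 k; z 0 k].
  exact: val_inj.
by rewrite !tE2 tE3 /gamma3 -expr2 => <-; ring.
Qed.

(** Summation by parts: the coefficients 11/6, -3, 3/2, -1/3 have partial sums 11/6, -7/6, 1/3, 0,
    the first three being those of [gamma3]. *)
Lemma bdf3_bdiff (R : realType) (M : nat) (U : nat -> 'rV[R]_M) (n : nat) :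
  (11 / 6) *: U n.+3 - 3 *: U n.+2 + (3 / 2) *: U n.+1 - (1 / 3) *: U n =
  (11 / 6) *: bdiff U n.+3 - (7 / 6) *: bdiff U n.+2
    + (1 / 3) *: bdiff U n.+1.
Proof. by apply/rowP => k; rewrite /bdiff !mxE /=; field. Qed.

Theorem theorem3p4 (R : realType) (M : nat) (F : 'rV[R]_M -> \bar R)
    (F_proper : eproper F)
    (F_lsc : lower_semicontinuous F)
    (F_semiconvex : semiconvex F)
    (F_cont : {within edom F, continuous F})
    (F_bounded_below : (-oo < ereal_inf (range F))%E)
    (dt : R) (dt_gt0 : 0 < dt)
    (U : nat -> 'rV[R]_M) (U_scheme : BDF3 F dt U)
    (dt_small : semiconvexity_cst F * dt < 2 * beta3 R)
    (beta : R)
    (beta_ge : semiconvexity_cst F * dt / 2 <= beta)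
    (beta_lt : beta < beta3 R)
    (q : 'M[R]_2) (r : 'M[R]_3) (qr_decomp : decomp3 beta q r)
    (n : nat) :
  (Fhat3 F dt q (Uhat U n.+3)
     + (dt^-1 * vqform r
          [tuple bdiff U n.+3; bdiff U n.+2; bdiff U n.+1])%:E
   <= Fhat3 F dt q (Uhat U n.+2))%E.
Proof.
have [W [FU3 /(_ (U n.+2))]] := U_scheme n.
have -> : U n.+2 - U n.+3 = - bdiff U n.+3 by rewrite opprB.
have -> : enorm (- bdiff U n.+3) ^+ 2 = dot (bdiff U n.+3) (bdiff U n.+3).
  by rewrite sqr_enorm /dot; apply: eq_bigr => i _; rewrite mxE mulrNN.
rewrite bdf3_bdiff dotNr => subW defW.
have := dot_gamma3 _ _ _ _ _ (bdiff U n.+3) (bdiff U n.+2) (bdiff U n.+1)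
  qr_decomp.
(* By the scheme the paired vector is [- dt *: W], so the identity evaluates [dt] times the linear
   term of the subgradient inequality. *)
rewrite -defW dotZl; move: subW FU3; rewrite /edom /Fhat3 /=.
move: (dot_ge0 _ _ (bdiff U n.+3)) (F_proper.1 (U n.+3)) (F_proper.1 (U n.+2)).
(* Properness rules out [-oo], and [U n.+3] lies in [edom F]; only [F (U n.+2)] may still be
   [+oo]. *)
case: (F (U n.+3)) => [f3||] //; case: (F (U n.+2)) => [f2||] //.
  move=> D_ge0 _ _; rewrite -!EFinD !lee_fin => subW _ gammaE.
  set Q32 := vqform q _ in gammaE *; set Q21 := vqform q _ in gammaE *.
  set R3 := vqform r _ in gammaE *.
  rewrite -(ler_pM2l dt_gt0) in subW; rewrite -(ler_pM2l dt_gt0).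
  rewrite !mulrDr !mulVKf ?gt_eqF //.
  have := ler_wpM2r D_ge0 beta_ge.
  move: subW gammaE; lra.
(* The right-hand side is [+oo]. This can occur only for [n = 0], as the scheme puts every iterate
   from [U 3] on in [edom F]. *)
by move=> *; rewrite addye // leey.
Qed.
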